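(* Let $\mathcal{A}$ and $\mathcal{B}$ be structures and let $F:Iso(\mathcal{A})\to Iso(\mathcal{B})$ be a functor. Then $F$ is computable if and only if there is an enumerable functor $G:Iso(\mathcal{A})\to Iso(\mathcal{B})$ that is effectively isomorphic to $F$.
   Context: Structures: all structures are countable with universe $\omega$, in a relational language $(R_i)_{i\in\omega}$ where $R_i$ has arity $a_i$ and $i\mapsto a_i$ is computable. The languages of $\mathcal{A}$ and $\mathcal{B}$ may differ. A class of structures (in a fixed language) is viewed as a category whose morphisms are the isomorphisms between its members; $Hom(\mathcal{A},\mathcal{B})$ is the set of isomorphisms from $\mathcal{A}$ to $\mathcal{B}$. $Iso(\mathcal{A})=\{\mathcal{C}:\mathcal{C}\cong\mathcal{A}\}$ (structures with universe $\omega$). A functor maps structures to structures and isomorphisms $f:\mathcal{C}\to\mathcal{D}$ to isomorphisms $F(f):F(\mathcal{C})\to F(\mathcal{D})$, preserving composition and identities. Coding: tuples of natural numbers are coded by numbers via a fixed computable coding $\langle\cdot\rangle$, and $\oplus$ and $\bigoplus_{i\in\omega}$ denote the usual effective joins of sets. The atomic diagram of $\mathcal{A}$ is $D(\mathcal{A})=\bigoplus_{i\in\omega}R_i^{\mathcal{A}}\oplus\bigoplus_{i\in\omega}\neg R_i^{\mathcal{A}}$, and $Graph(f)=\{\langle x,y\rangle: f(x)=y\}$. An enumeration operator $\Psi$ is a c.e. set of pairs $(E,x)$ with $E$ (a code of) a finite set, and $\Psi^X=\{x:\exists E\subseteq X\ (E,x)\in\Psi\}$. For a Turing operator $\Phi$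 and a set $Y$, $\Phi^X=Y$ means that $\Phi$ computes the characteristic function of $Y$ from the oracle $X$; for a function $g$, $\Phi^X=g$ means $\Phi$ computes $g$ from $X$. A functor $F:\mathfrak{C}\to\mathfrak{D}$ is computable if there are Turing operators $\Phi,\Phi_*$ such that for all $\mathcal{C}_1,\mathcal{C}_2\in\mathfrak{C}$: (1) $\Phi^{D(\mathcal{C}_1)}=D(F(\mathcal{C}_1))$; (2) for all $f\in Hom(\mathcal{C}_1,\mathcal{C}_2)$, $\Phi_*^{D(\mathcal{C}_1)\oplus Graph(f)\oplus D(\mathcal{C}_2)}=F(f)$. A functor $F:\mathfrak{C}\to\mathfrak{D}$ is enumerable if there are enumeration operators $\Psi,\Psi_*$ such that for all $\mathcal{C}_1,\mathcal{C}_2\in\mathfrak{C}$: (1) $\Psi^{D(\mathcal{C}_1)}=D(F(\mathcal{C}_1))$; (2) for all $f\in Hom(\mathcal{C}_1,\mathcal{C}_2)$, $\Psi_*^{D(\mathcal{C}_1)\oplus Graph(f)\oplus D(\mathcal{C}_2)}=Graph(F(f))$. A functor $F:\mathfrak{C}\to\mathfrak{D}$ is effectively isomorphic to a functor $G:\mathfrak{C}\to\mathfrak{D}$ if there is a Turing functional $\Lambda$ such that for every $\mathcal{C}\in\mathfrak{C}$, $\Lambda^{\mathcal{C}}$ (computed with oracle $D(\mathcal{C})$) is an isomorphism $F(\mathcal{C})\to G(\mathcal{C})$, and for every morphism $h\in Hom(\mathcal{C}_1,\mathcal{C}_2)$ in $\mathfrak{C}$, $\Lambda^{\mathcal{C}_2}\circ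 F(h)=G(h)\circ\Lambda^{\mathcal{C}_1}$. *)

(* Defs.v *)
From mathcomp Require Import all_boot.
From Stdlib Require Cantor.

Set Implicit Arguments.
Unset Strict Implicit.
Unset Printing Implicit Defensive.

Definition natset := nat -> Prop.

(* The fixed computable coding of pairs (Cantor pairing, a bijection) and, by
   iteration, of finite sequences (also a bijection). *)
Definition cpair (x y : nat) : nat := Cantor.to_nat (x, y).

Fixpoint cseq (s : seq nat) : nat :=
  if s is x :: s' then (cpair x (cseq s')).+1 else 0.

Definition join (X Y : natset) : natset := fun n =>
  (exists2 x, X x & n = x.*2) \/ (exists2 y, Y y & n = y.*2.+1).

Definition bigjoin (X : nat -> natset) : natset := fun n =>
  exists i x, X i x /\ n = cpair i x.

Definition graph (f : nat -> nat) : natset := fun n =>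
  exists x y, f x = y /\ n = cpair x y.

(* Programs for the partial recursive functionals with a set oracle (Kleene's
   schemes). Programs are unary; several arguments are passed through [cpair]. *)
Inductive code : Type :=
| Zero
| Succ
| Fst
| Snd
| Oracle
| Pair of code & code
| Comp of code & code
| Prec of code & code
| Mu of code.

Fixpoint prec_rel (P Q : nat -> nat -> Prop) (a k m : nat) : Prop :=
  if k is k'.+1 then
    exists2 r, prec_rel P Q a k' r & Q (cpair a (cpair k' r)) m
  else P a m.

(* [eval X c n m]: program [c] with oracle [X] halts on input [n] with output
   [m]. The oracle is queried through its characteristic function. *)
Fixpoint eval (X : natset) (c : code) (n m : nat) : Prop :=
  match c with
  | Zero => m = 0
  | Succ => m = n.+1
  | Fst => m = (Cantor.of_nat n).1
  | Snd => m = (Cantor.of_nat n).2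
  | Oracle => X n /\ m = 1 \/ ~ X n /\ m = 0
  | Pair c d => exists u v, [/\ eval X c n u, eval X d n v & m = cpair u v]
  | Comp c d => exists2 u, eval X d n u & eval X c u m
  | Prec c d =>
      prec_rel (eval X c) (eval X d) (Cantor.of_nat n).1 (Cantor.of_nat n).2 m
  | Mu c => eval X c (cpair n m) 0 /\
            (forall k, k < m -> exists v, eval X c (cpair n k) v.+1)
  end.

Definition computes_fun (X : natset) (c : code) (g : nat -> nat) : Prop :=
  forall n, eval X c n (g n).

Definition computes_set (X : natset) (c : code) (Y : natset) : Prop :=
  forall n, (Y n -> eval X c n 1) /\ (~ Y n -> eval X c n 0).

Definition no_oracle : natset := fun _ => False.

Definition computable_fun (g : nat -> nat) : Prop :=
  exists c, computes_fun no_oracle c g.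

Definition ce (W : natset) : Prop :=
  exists c, forall n, W n <-> exists m, eval no_oracle c n m.

(* An enumeration operator is a c.e. set W of codes of pairs (E, x), the finite
   set E being coded by [cseq s] for any list s of its elements. *)
Definition enum_apply (W X : natset) : natset := fun x =>
  exists s : seq nat, (forall y, y \in s -> X y) /\ W (cpair (cseq s) x).

Record language := Language {
  arity : nat -> nat;
  arity_computable : computable_fun arity }.

Definition structure (L : language) : Type :=
  forall i : nat, (arity L i).-tuple nat -> Prop.

Definition tuple_codes (n : nat) (P : n.-tuple nat -> Prop) : natset := fun x =>
  exists2 t : n.-tuple nat, P t & x = cseq t.

Definition diagram (L : language) (C : structure L) : natset :=
  join (bigjoin (fun i => tuple_codes (C i)))
       (bigjoin (fun i => tuple_codes (fun t => ~ C i t))).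

Definition is_iso (L : language) (C D : structure L) (f : nat -> nat) : Prop :=
  bijective f /\ forall i (t : (arity L i).-tuple nat),
    C i t <-> D i (map_tuple f t).

Record iso (L : language) (C D : structure L) := Iso {
  iso_fun :> nat -> nat;
  iso_funP : is_iso C D iso_fun }.

Lemma is_iso_id (L : language) (C : structure L) : is_iso C C id.
Proof.
split; first by exists id.
by move=> i t; rewrite (_ : map_tuple id t = t) //; apply/val_inj/map_id.
Qed.

Lemma is_iso_comp (L : language) (C D E : structure L) (g f : nat -> nat) :
  is_iso D E g -> is_iso C D f -> is_iso C E (g \o f).
Proof.
move=> [bg Hg] [bf Hf]; split; first exact: bij_comp.
move=> i t; rewrite Hf Hg.
rewrite (_ : map_tuple g _ = map_tuple (g \o f) t) //.
by apply/val_inj; rewrite /= map_comp.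
Qed.

Definition iso_id (L : language) (C : structure L) : iso C C :=
  Iso (is_iso_id C).

Definition iso_comp (L : language) (C D E : structure L)
    (g : iso D E) (f : iso C D) : iso C E :=
  Iso (is_iso_comp (iso_funP g) (iso_funP f)).

Definition struct_class (L : language) := structure L -> Prop.

Definition iso_class (L : language) (A : structure L) : struct_class L :=
  fun C => inhabited (iso C A).

Record obj (L : language) (K : struct_class L) := Obj {
  obj_struct :> structure L;
  obj_in : K obj_struct }.

Record functor (L1 L2 : language) (K1 : struct_class L1)
    (K2 : struct_class L2) := Functor {
  fobj :> obj K1 -> obj K2;
  fmap : forall C D : obj K1, iso C D -> iso (fobj C) (fobj D);
  fmap_id : forall C : obj K1, fmap (iso_id C) =1 iso_id (fobj C);
  fmap_comp : forall (C D E : obj K1) (g : iso D E) (f : iso C D),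
    fmap (iso_comp g f) =1 iso_comp (fmap g) (fmap f) }.

Definition hom_oracle (L : language) (C D : structure L) (f : iso C D) : natset :=
  join (join (diagram C) (graph f)) (diagram D).

Definition computable_functor (L1 L2 : language) (K1 : struct_class L1)
    (K2 : struct_class L2) (F : functor K1 K2) : Prop :=
  exists Phi Phi' : code, forall C1 C2 : obj K1,
    computes_set (diagram C1) Phi (diagram (F C1)) /\
    forall f : iso C1 C2, computes_fun (hom_oracle f) Phi' (fmap F f).

Definition enumerable_functor (L1 L2 : language) (K1 : struct_class L1)
    (K2 : struct_class L2) (F : functor K1 K2) : Prop :=
  exists Psi Psi' : natset, [/\ ce Psi, ce Psi' & forall C1 C2 : obj K1,
    (forall x, enum_apply Psi (diagram C1) x <-> diagram (F C1) x) /\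
    forall (f : iso C1 C2) x,
      enum_apply Psi' (hom_oracle f) x <-> graph (fmap F f) x].

Definition effectively_isomorphic_to (L1 L2 : language) (K1 : struct_class L1)
    (K2 : struct_class L2) (F G : functor K1 K2) : Prop :=
  exists (Lam : code) (lam : forall C : obj K1, iso (F C) (G C)),
    (forall C : obj K1, computes_fun (diagram C) Lam (lam C)) /\
    forall (C1 C2 : obj K1) (h : iso C1 C2),
      lam C2 \o fmap F h =1 fmap G h \o lam C1.

(* Main.v *)
Require Import Defs.
From mathcomp Require Import all_boot zify.
From Stdlib Require Import ClassicalEpsilon.
From Stdlib Require Cantor.

Set Implicit Arguments.
Unset Strict Implicit.
Unset Printing Implicit Defensive.

(** The diagram of a structure lists the negated atomic facts along with the
    atomic ones, and the graph of a function contains a pair [(x, y')] with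
    [y' <> y] whenever it does not contain [(x, y)]. So the oracles and the
    outputs of functors are all _refutable_: a computable relation [r] tells
    that [n] is outside [X] exactly when [r y n] holds for some element [y] of
    [X]. For such sets, positive information is as good as full information,
    and reducibility by an enumeration operator coincides with Turing
    reducibility, uniformly in families of sets. Hence a functor is computable
    if and only if it is itself enumerable ([computable_iff_enumerable]), which
    gives the theorem with [G := F] in one direction; in the other one, [G] is
    computable and computability is transferred along the natural isomorphism.

    From Turing to enumeration ([enumerable_of_computable]): a halting
    computation asks the oracle finitely many questions, so it can be run with
    a finite list of elements of [X] instead of [X], a negative answer being
    backed by an element of the list that refutes the question. The operator is
    the set of pairs of a list and an input on which this simulation answers
    yes. It is c.e. because the simulation, cut off after a given number of
    steps, is total computable ([cf_sim]), and it is correct because any answer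
    of the simulation is right ([sim_sound]) and any computation is simulated
    once the list and the bound are large enough ([sim_complete]).

    From enumeration to Turing ([computable_of_enumerable]): to decide whether
    [n] is in [Y], enumerate [Y] until [n] or a refutation of [n] appears.

    Transfer ([computable_functor_transfer]): if [lam C : G C -> F C] is
    computable from the diagram of [C], so is its inverse, by search. A literal
    holds in [F C] when its image under the inverse of [lam C] holds in [G C],
    and [F h] is the composite of [lam], [G h] and the inverse of [lam]. *)

(** * Pairs and coded sequences *)

Definition car (n : nat) : nat := (Cantor.of_nat n).1.
Definition cdr (n : nat) : nat := (Cantor.of_nat n).2.

Lemma car_cpair x y : car (cpair x y) = x.
Proof. by rewrite /car /cpair Cantor.cancel_of_to. Qed.

Lemma cdr_cpair x y : cdr (cpair x y) = y.
Proof. by rewrite /cdr /cpair Cantor.cancel_of_to. Qed.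

Lemma cpairE n : cpair (car n) (cdr n) = n.
Proof. by rewrite /cpair /car /cdr -surjective_pairing Cantor.cancel_to_of. Qed.

Lemma leq_cdr_cpair x y : y <= cpair x y.
Proof. by have := Cantor.to_nat_non_decreasing x y; rewrite /cpair; lia. Qed.

Lemma cpair_surj n : exists x y, n = cpair x y.
Proof. by exists (car n), (cdr n); rewrite cpairE. Qed.

Definition cpairK := (car_cpair, cdr_cpair).

Lemma cseq_surj n : exists s, cseq s = n.
Proof.
elim/ltn_ind: n => -[|n] IHn; first by exists [::].
have [x [y def_n]] := cpair_surj n.
have [|s def_y] := IHn y; first by rewrite ltnS def_n leq_cdr_cpair.
by exists (x :: s); rewrite /= def_y -def_n.
Qed.

(** Only the inversion laws matter: computations with [decode n] go through
    [cf_foldl] below, which reads the code [n] itself. *)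
Definition decode (n : nat) : seq nat :=
  projT1 (constructive_indefinite_description _ (cseq_surj n)).

Lemma decodeK : cancel decode cseq.
Proof. by move=> n; rewrite /decode; case: constructive_indefinite_description. Qed.

Lemma cseq_inj : injective cseq.
Proof.
elim=> [|x s IHs] [|y t] //= [/(congr1 (fun n => (car n, cdr n)))].
by rewrite !cpairK => -[-> /IHs->].
Qed.

Lemma cseqK : cancel cseq decode.
Proof. exact: inj_can_sym decodeK cseq_inj. Qed.

Lemma size_cseq s : size s <= cseq s.
Proof. by elim: s => //= x s IHs; rewrite ltnS (leq_trans IHs) ?leq_cdr_cpair. Qed.

(** * Programs *)

Lemma prec_rel_det (P Q : nat -> nat -> Prop) a k m m' :
  (forall x u v, P x u -> P x v -> u = v) ->
  (forall x u v, Q x u -> Q x v -> u = v) ->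
  prec_rel P Q a k m -> prec_rel P Q a k m' -> m = m'.
Proof.
move=> detP detQ; elim: k m m' => [|k IHk] m m' /=; first exact: detP.
by move=> [r rk Qr] [r' /(IHk _ _ rk)<-]; apply: detQ Qr.
Qed.

Lemma eval_det X c n m m' : eval X c n m -> eval X c n m' -> m = m'.
Proof.
elim: c n m m' => [||||| c IHc d IHd | c IHc d IHd | c IHc d IHd | c IHc] n m m' /=;
  try by move=> -> ->.
- by case=> -[Xn ->] [] [X'n ->].
- move=> [u [v [cu dv ->]]] [u' [v' [/(IHc _ _ _ cu)<- /(IHd _ _ _ dv)<- ->]]] //.
- by move=> [u du cm] [u' /(IHd _ _ _ du)<-]; apply: IHc.
- exact: prec_rel_det.
- move=> [cm lt_m] [cm' lt_m'].
  have [/lt_m' [v cv] | /lt_m [v cv] | //] := ltngtP m m'.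
    by have := IHc _ _ _ cv cm.
  by have := IHc _ _ _ cv cm'.
Qed.

(** Transitivity of Turing reducibility at the level of programs: each question
    to the oracle is answered by running [d]. *)
Fixpoint subst_oracle (d c : code) : code :=
  match c with
  | Oracle => d
  | Pair c1 c2 => Pair (subst_oracle d c1) (subst_oracle d c2)
  | Comp c1 c2 => Comp (subst_oracle d c1) (subst_oracle d c2)
  | Prec c1 c2 => Prec (subst_oracle d c1) (subst_oracle d c2)
  | Mu c1 => Mu (subst_oracle d c1)
  | _ => c
  end.

Lemma eval_subst_oracle X Y d c n m :
  computes_set X d Y -> eval Y c n m -> eval X (subst_oracle d c) n m.
Proof.
move=> XdY; elim: c n m => [||||| c IHc e IHe | c IHc e IHe | c IHc e IHe | c IHc] n m //=.
- by case=> -[Yn ->]; [apply: (XdY n).1 | apply: (XdY n).2].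
- by move=> [u [v [cu dv ->]]]; exists u, v; split; auto.
- by move=> [u du cm]; exists u; auto.
- elim: (Cantor.of_nat n).2 m => [|k IHk] m /=; first exact: IHc.
  by move=> [r rk Qr]; exists r; auto.
- move=> [cm lt_m]; split=> [|k /lt_m[v cv]]; first exact: IHc.
  by exists v; apply: IHc.
Qed.

(** * Functions computable from a family of oracles *)

(** Computability of [g i] from [O i] by a single program for all [i]. All the
    uniformity requirements on functors are of this form, the index being an
    object or a morphism. *)
Definition computable_from (I : Type) (O : I -> natset) (g : I -> nat -> nat) :=
  exists c, forall i, computes_fun (O i) c (g i).

(** Membership is not decidable, so characteristic functions exist only
    classically; they let sets be treated as functions. *)
Definition chi (X : natset) (n : nat) : bool :=
  if excluded_middle_informative (X n) then true else false.

Lemma chiP X n : reflect (X n) (chi X n).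
Proof. by rewrite /chi; case: excluded_middle_informative => Xn; constructor. Qed.

Lemma computes_setE X c Y : computes_set X c Y <-> computes_fun X c (chi Y).
Proof.
split=> XcY n; last by have := XcY n; case: chiP; split.
by case: chiP => Yn; [apply: (XcY n).1 | apply: (XcY n).2].
Qed.

(** The change of oracle that turns computability from diagrams of objects into
    computability from oracles of morphisms. *)
Lemma computable_from_reindex I J (O : I -> natset) (O' : J -> natset) g (f : J -> I) :
  computable_from O' (fun j n => chi (O (f j)) n) -> computable_from O g ->
  computable_from O' (fun j => g (f j)).
Proof.
move=> [d Hd] [c Hc]; exists (subst_oracle d c) => j n.
exact: eval_subst_oracle ((computes_setE _ _ _).2 (Hd j)) (Hc (f j) n).
Qed.

Section Closure.
Context {I : Type} {O : I -> natset}.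
Local Notation CF := (computable_from O).
Implicit Types f g h : I -> nat -> nat.

Lemma eq_computable_from f g : (forall i, f i =1 g i) -> CF f -> CF g.
Proof. by move=> eqfg [c Hc]; exists c => i n; rewrite -eqfg; apply: Hc. Qed.

Lemma cf_oracle : CF (fun i n => chi (O i) n).
Proof. by exists Oracle => i n /=; case: chiP; [left | right]. Qed.

Lemma cf_id : CF (fun _ n => n).
Proof.
exists (Pair Fst Snd) => i n /=; exists (car n), (cdr n).
by rewrite cpairE.
Qed.

Lemma cf_comp f g : CF f -> CF g -> CF (fun i n => f i (g i n)).
Proof.
move=> [c Hc] [d Hd]; exists (Comp c d) => i n.
by exists (g i n); [apply: Hd | apply: Hc].
Qed.

Lemma cf_pair f g : CF f -> CF g -> CF (fun i n => cpair (f i n) (g i n)).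
Proof.
move=> [c Hc] [d Hd]; exists (Pair c d) => i n.
by exists (f i n), (g i n); split; [apply: Hc | apply: Hd |].
Qed.

Lemma cf_succ f : CF f -> CF (fun i n => (f i n).+1).
Proof. by apply: (@cf_comp (fun _ n => n.+1)); exists Succ. Qed.

Lemma cf_car f : CF f -> CF (fun i n => car (f i n)).
Proof. by apply: (@cf_comp (fun _ n => car n)); exists Fst. Qed.

Lemma cf_cdr f : CF f -> CF (fun i n => cdr (f i n)).
Proof. by apply: (@cf_comp (fun _ n => cdr n)); exists Snd. Qed.

Lemma cf_const k : CF (fun _ _ => k).
Proof. by elim: k => [|k]; [exists Zero | apply: cf_succ]. Qed.

Lemma cf_computable_fun (u : nat -> nat) f :
  computable_fun u -> CF f -> CF (fun i n => u (f i n)).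
Proof.
move=> [c Hc]; apply: (@cf_comp (fun _ n => u n)).
(* Without oracle, every question is answered by 0. *)
exists (subst_oracle Zero c) => i n; apply: eval_subst_oracle (Hc n) => y.
by split.
Qed.

(** The step function [h] receives the argument [n], so that it may depend on
    it, then the counter and the value reached so far, all packed in one
    number. *)
Lemma cf_iteri f k (h : I -> nat -> nat -> nat -> nat) :
  CF f -> CF k -> CF (fun i z => h i (car z) (car (cdr z)) (cdr (cdr z))) ->
  CF (fun i n => iteri (k i n) (h i n) (f i n)).
Proof.
move=> [c Hc] kP [d Hd].
have recP: CF (fun i z => iteri (cdr z) (h i (car z)) (f i (car z))).
  exists (Prec c d) => i z /=; rewrite -/(car z) -/(cdr z).
  elim: (cdr z) => [|l IHl] /=; first exact: Hc.
  eexists; first exact: IHl.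
  by have := Hd i (cpair (car z) (cpair l (iteri l (h i (car z)) (f i (car z))))); rewrite !cpairK.
apply: eq_computable_from (cf_comp recP (cf_pair cf_id kP)) => i n.
by rewrite !cpairK.
Qed.

Lemma cf_iter f k (h : I -> nat -> nat -> nat) :
  CF f -> CF k -> CF (fun i z => h i (car z) (cdr z)) ->
  CF (fun i n => iter (k i n) (h i n) (f i n)).
Proof.
move=> Pf Pk Ph.
have := cf_iteri (h := fun i n _ => h i n) Pf Pk _; apply.
have := cf_comp Ph (cf_pair (cf_car cf_id) (cf_cdr (cf_cdr cf_id))).
by apply: eq_computable_from => i z; rewrite !cpairK.
Qed.

Lemma cf_pred f : CF f -> CF (fun i n => (f i n).-1).
Proof.
move=> Pf; apply: (eq_computable_from (f := fun i n => iteri (f i n) (fun k _ => k) 0)).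
  by move=> i n; case: (f i n).
exact: (cf_iteri (h := fun _ _ k _ => k)) (cf_const 0) Pf (cf_car (cf_cdr cf_id)).
Qed.

Lemma cf_add f g : CF f -> CF g -> CF (fun i n => f i n + g i n).
Proof.
move=> Pf Pg; apply: (eq_computable_from (f := fun i n => iteri (f i n) (fun _ r => r.+1) (g i n))).
  by move=> i n; elim: (f i n) => //= k ->.
exact: (cf_iteri (h := fun _ _ _ r => r.+1)) Pg Pf (cf_succ (cf_cdr (cf_cdr cf_id))).
Qed.

Lemma cf_sub f g : CF f -> CF g -> CF (fun i n => f i n - g i n).
Proof.
move=> Pf Pg; apply: (eq_computable_from (f := fun i n => iteri (g i n) (fun _ r => r.-1) (f i n))).
  by move=> i n; elim: (g i n) => [|k /= ->]; rewrite ?subn0 ?subnS.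
exact: (cf_iteri (h := fun _ _ _ r => r.-1)) Pf Pg (cf_pred (cf_cdr (cf_cdr cf_id))).
Qed.

Lemma cf_if (p : I -> nat -> bool) f g :
  CF (fun i n => p i n) -> CF f -> CF g -> CF (fun i n => if p i n then f i n else g i n).
Proof.
move=> Pp Pf Pg.
apply: (eq_computable_from (f := fun i n => iteri (p i n) (fun _ _ => f i n) (g i n))).
  by move=> i n; case: (p i n).
exact: (cf_iteri (h := fun i n _ _ => f i n)) Pg Pp (cf_comp Pf (cf_car cf_id)).
Qed.

Implicit Types p q : I -> nat -> bool.

Lemma cf_and p q : CF p -> CF q -> CF (fun i n => p i n && q i n).
Proof.
move=> Pp Pq; apply: eq_computable_from (cf_if Pp Pq (cf_const 0)) => i n.
by case: (p i n).
Qed.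

Lemma cf_neg p : CF p -> CF (fun i n => ~~ p i n).
Proof.
move=> Pp; apply: eq_computable_from (cf_if Pp (cf_const 0) (cf_const 1)) => i n.
by case: (p i n).
Qed.

Lemma cf_or p q : CF p -> CF q -> CF (fun i n => p i n || q i n).
Proof.
move=> Pp Pq; apply: eq_computable_from (cf_if Pp (cf_const 1) Pq) => i n.
by case: (p i n).
Qed.

Lemma cf_neq0 f : CF f -> CF (fun i n => f i n != 0).
Proof.
move=> Pf; apply: eq_computable_from (cf_sub Pf (cf_pred Pf)) => i n.
by case: (f i n) => //= k; rewrite subSnn.
Qed.

Lemma cf_eq f g : CF f -> CF g -> CF (fun i n => f i n == g i n).
Proof.
move=> Pf Pg.
apply: eq_computable_from
  (cf_neg (cf_neq0 (cf_add (cf_sub Pf Pg) (cf_sub Pg Pf)))) => i n.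
by congr nat_of_bool; lia.
Qed.

Lemma cf_odd f : CF f -> CF (fun i n => odd (f i n)).
Proof.
move=> Pf.
apply: (eq_computable_from (f := fun i n => iteri (f i n) (fun _ r => ~~ (r != 0)) 0)).
  by move=> i n; elim: (f i n) => //= k ->; case: odd.
apply: (cf_iteri (h := fun _ _ _ r => ~~ (r != 0))) (cf_const 0) Pf _.
exact: cf_neg (cf_neq0 (cf_cdr (cf_cdr cf_id))).
Qed.

Lemma cf_half f : CF f -> CF (fun i n => (f i n)./2).
Proof.
move=> Pf; apply: (eq_computable_from (f := fun i n => iteri (f i n) (fun k r => odd k + r) 0)).
  by move=> i n; elim: (f i n) => //= k ->; rewrite uphalf_half.
apply: (cf_iteri (h := fun _ _ k r => odd k + r)) (cf_const 0) Pf _.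
exact: cf_add (cf_odd (cf_car (cf_cdr cf_id))) (cf_cdr (cf_cdr cf_id)).
Qed.

Lemma cf_double f : CF f -> CF (fun i n => (f i n).*2).
Proof. by move=> Pf; apply: eq_computable_from (cf_add Pf Pf) => i n; rewrite addnn. Qed.

(** All the list functions needed are left folds, which only require to split
    repeatedly the code of a nonempty sequence into its head and its tail. *)
Lemma cf_foldl (h : I -> nat -> nat -> nat -> nat) f l :
  CF (fun i z => h i (car z) (car (cdr z)) (cdr (cdr z))) -> CF f -> CF l ->
  CF (fun i n => foldl (h i n) (f i n) (decode (l i n))).
Proof.
move=> Ph Pf Pl.
(* The state packs the value reached so far with the code of the sequence still
   to be read, and is stationary once that code is 0. *)
pose step i n (r : nat) := if cdr r != 0 then
  cpair (h i n (car r) (car (cdr r).-1)) (cdr (cdr r).-1) else r.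
have stepE i n a s : iter (size s) (step i n) (cpair a (cseq s)) =
    cpair (foldl (h i n) a s) 0.
  elim: s a => // x s IHs a; rewrite iterSr.
  by rewrite [step _ _ _]/step /= !cpairK /= ?cpairK IHs.
have stepS i n a s m : size s <= m ->
    iter m (step i n) (cpair a (cseq s)) = cpair (foldl (h i n) a s) 0.
  move=> /subnK<-; elim: (m - size s) => [|k /= ->]; first exact: stepE.
  by rewrite /step cdr_cpair.
(* A sequence is no longer than its code, so [l i n] steps are enough. *)
apply: (eq_computable_from (f := fun i n =>
    car (iter (l i n) (step i n) (cpair (f i n) (l i n))))).
  move=> i n; rewrite -{2}[l i n]decodeK stepS ?car_cpair //.
  by rewrite -{2}[l i n]decodeK size_cseq.
apply/cf_car/(cf_iter (h := step)) => //; first exact: cf_pair.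
have Pr: CF (fun _ z => cdr z) by exact: cf_cdr cf_id.
have Pr': CF (fun _ z => (cdr (cdr z)).-1) by exact: cf_pred (cf_cdr Pr).
apply: (cf_if (cf_neq0 (cf_cdr Pr)) (cf_pair _ (cf_cdr Pr')) Pr).
have := cf_comp Ph (cf_pair (cf_car cf_id) (cf_pair (cf_car Pr) (cf_car Pr'))).
by apply: eq_computable_from => i z; rewrite !cpairK.
Qed.

Lemma cf_size l : CF l -> CF (fun i n => size (decode (l i n))).
Proof.
move=> Pl; apply: (eq_computable_from (f := fun i n =>
    foldl (fun a _ => a.+1) 0 (decode (l i n)))).
  move=> i n; rewrite -[RHS]add0n; elim: (decode _) 0 => [|x s IHs] a /=; first by rewrite addn0.
  by rewrite IHs addSnnS.
exact: (cf_foldl (h := fun _ _ a _ => a.+1)) (cf_succ (cf_car (cf_cdr cf_id))) (cf_const 0) Pl.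
Qed.

Lemma cf_has (p : I -> nat -> nat -> bool) l :
  CF (fun i z => p i (car z) (cdr z)) -> CF l ->
  CF (fun i n => has (p i n) (decode (l i n))).
Proof.
move=> Pp Pl; apply: (eq_computable_from (f := fun i n =>
    foldl (fun a x => (a != 0) || p i n x) 0 (decode (l i n)))).
  move=> i n.
  suff E (b : bool) s : foldl (fun a x => (a != 0) || p i n x) b s = (b || has (p i n) s) :> nat.
    exact: (E false).
  elim: s b => [|x s IHs] b /=; first by rewrite orbF.
  by rewrite IHs orbA; case: b.
apply: (cf_foldl (h := fun i n a x => (a != 0) || p i n x)) (cf_const 0) Pl.
apply: cf_or (cf_neq0 (cf_car (cf_cdr cf_id))) _.
have := cf_comp Pp (cf_pair (cf_car cf_id) (cf_cdr (cf_cdr cf_id))).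
by apply: eq_computable_from => i z; rewrite !cpairK.
Qed.

Lemma cf_all (p : I -> nat -> nat -> bool) l :
  CF (fun i z => p i (car z) (cdr z)) -> CF l ->
  CF (fun i n => all (p i n) (decode (l i n))).
Proof.
move=> Pp Pl.
apply: eq_computable_from (cf_neg (cf_has (p := fun i n x => ~~ p i n x) (cf_neg Pp) Pl)) => i n.
by rewrite -all_predC; congr nat_of_bool; apply: eq_all => x /=; rewrite negbK.
Qed.

Lemma cf_map (f : I -> nat -> nat) l : CF f -> CF l ->
  CF (fun i n => cseq (map (f i) (decode (l i n)))).
Proof.
(* A left fold builds the list of images in reverse order. *)
have rev_map g l' : CF g -> CF l' -> CF (fun i n => cseq (rev (map (g i) (decode (l' i n))))).
  move=> Pg Pl; apply: (eq_computable_from (f := fun i n =>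
      foldl (fun a x => (cpair (g i x) a).+1) 0 (decode (l' i n)))).
    move=> i n.
    suff E t s : foldl (fun a x => (cpair (g i x) a).+1) (cseq t) s =
        cseq (rev (map (g i) s) ++ t) by rewrite (E [::]) cats0.
    elim: s t => //= x s IHs t.
    by rewrite -/(cseq (g i x :: t)) IHs rev_cons cat_rcons.
  apply: (cf_foldl (h := fun i _ a x => (cpair (g i x) a).+1)) (cf_const 0) Pl.
  exact: cf_succ (cf_pair (cf_comp Pg (cf_cdr (cf_cdr cf_id))) (cf_car (cf_cdr cf_id))).
move=> Pf Pl; apply: eq_computable_from (rev_map _ _ cf_id (rev_map _ _ Pf Pl)) => i n /=.
by rewrite cseqK map_id revK.
Qed.

(** Unbounded search, when it always succeeds. *)
Lemma cf_search (p : I -> nat -> nat -> bool) :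
  CF (fun i z => p i (car z) (cdr z)) -> (forall i n, exists m, p i n m) ->
  exists2 f, CF f & forall i n, p i n (f i n).
Proof.
(* Minimization looks for the value 0, hence the negation of [p]. *)
move=> /cf_neg[c Hc] ex_p.
exists (fun i n => ex_minn (ex_p i n)); last by move=> i n; case: ex_minnP.
exists (Mu c) => i n /=; case: ex_minnP => m pm min_m; split.
  by have := Hc i (cpair n m); rewrite !cpairK pm.
move=> k lt_km; exists 0; have := Hc i (cpair n k); rewrite !cpairK.
by case: (boolP (p i n k)) => // /min_m; rewrite leqNgt lt_km.
Qed.

End Closure.

Lemma ce_exists (p : nat -> nat -> bool) :
  computable_fun (fun z => p (car z) (cdr z)) -> ce (fun n => exists m, p n m).
Proof.
move=> [c0 Hc0].
have [c /(_ tt) Hc]: computable_from (fun _ : unit => no_oracle) (fun _ z => ~~ p (car z) (cdr z)).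
  by apply: cf_neg; exists c0 => _.
exists (Mu c) => n; split=> [ex_p | [m [cm _]]].
  exists (ex_minn ex_p); case: ex_minnP => m pm min_m; split.
    by have := Hc (cpair n m); rewrite !cpairK pm.
  move=> k lt_km; exists 0; have := Hc (cpair n k); rewrite !cpairK.
  by case: (boolP (p n k)) => // /min_m; rewrite leqNgt lt_km.
exists m; have := eval_det (Hc (cpair n m)) cm; rewrite !cpairK.
by case: (p n m).
Qed.

(** * Simulation with limited resources *)

(** The value is 0 if no answer is obtained, and [m.+1] if the answer is [m];
    [a] answers the questions to the oracle in the same format. Only
    minimization may run forever, so [t] bounds the number of values that it
    tries and makes the function total. *)
Fixpoint sim (a : nat -> nat) (t : nat) (c : code) (n : nat) : nat :=
  match c with
  | Zero => 1
  | Succ => n.+2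
  | Fst => (car n).+1
  | Snd => (cdr n).+1
  | Oracle => a n
  | Pair c d =>
      if (sim a t c n != 0) && (sim a t d n != 0)
      then (cpair (sim a t c n).-1 (sim a t d n).-1).+1 else 0
  | Comp c d => if sim a t d n != 0 then sim a t c (sim a t d n).-1 else 0
  | Prec c d =>
      iteri (cdr n) (fun k r =>
        if r != 0 then sim a t d (cpair (car n) (cpair k r.-1)) else 0)
        (sim a t c (car n))
  | Mu c =>
      (* State 0: no value obtained for some [k]; state 1: only nonzero values
         so far; state [k.+2]: the first zero is at [k]. *)
      (iteri t (fun k r =>
        if r == 1 then
          if sim a t c (cpair n k) == 1 then k.+2
          else sim a t c (cpair n k) != 0
        else r) 1).-1
  end.

(** A missing answer blocks the simulation instead of being guessed, so the
    partial oracle [a] need only be right where it answers. *)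
Lemma sim_sound X a t c n m :
  (forall y v, a y = v.+1 -> v = chi X y) -> sim a t c n = m.+1 -> eval X c n m.
Proof.
move=> aX; elim: c n m => [||||| c IHc d IHd | c IHc d IHd | c IHc d IHd | c IHc] n m /=.
- by case.
- by case.
- by case.
- by case.
- by move=> /aX->; case: chiP; [left | right].
- case cE: sim => [|u] //=; case dE: sim => [|v] //= -[<-].
  by exists u, v; split; auto.
- by case dE: sim => [|v] //= cE; exists v; auto.
- rewrite -/(car n) -/(cdr n); elim: (cdr n) m => [|k IHk] m /=; first exact: IHc.
  by case rE: (iteri _ _ _) => [|r] //= /IHd Hr; exists r; auto.
set F := fun k r : nat => _.
have inv k : match iteri k F 1 with
    | 0 => True
    | 1 => forall j, j < k -> exists v, eval X c (cpair n j) v.+1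
    | l.+2 => eval X (Mu c) n l
    end.
  elim: k => [|k IHk] //=; rewrite {1}/F.
  case: (iteri _ _ _) IHk => [|[|l]] //= lt_k.
  case cE: sim => [|[|v]] //=; first by split=> //; apply: IHc.
  move=> j; rewrite ltnS leq_eqVlt => /predU1P[-> | /lt_k //].
  by exists v; apply: IHc.
by have := inv t; case: (iteri _ _ _) => [|[|l]] //= Hl [<-].
Qed.

(** The use principle for a property of the resources of a simulation: finitely
    many correct answers about [X] and a large enough bound bring it about. The
    filter so defined is closed under finite conjunctions, which is all that
    the induction on programs requires. *)
Definition forced (X : natset) (P : (nat -> nat) -> nat -> Prop) : Prop :=
  exists (q : seq nat) t0, forall a t,
    t0 <= t -> {in q, forall y, a y = (chi X y).+1} -> P a t.

Lemma forced_imply X P Q : (forall a t, P a t -> Q a t) -> forced X P -> forced X Q.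
Proof. by move=> sPQ [q [t0 H]]; exists q, t0 => a t *; apply/sPQ/H. Qed.

Lemma forced_and X P Q :
  forced X P -> forced X Q -> forced X (fun a t => P a t /\ Q a t).
Proof.
move=> [q [t0 HP]] [q' [t0' HQ]]; exists (q ++ q'), (maxn t0 t0') => a t.
rewrite geq_max => /andP[le_t le_t'] aE.
split; [apply: HP | apply: HQ] => // y qy; apply: aE;
  by rewrite mem_cat qy ?orbT.
Qed.

Lemma forced_forall X (P : nat -> (nat -> nat) -> nat -> Prop) m :
  (forall k, k < m -> forced X (P k)) ->
  forced X (fun a t => forall k, k < m -> P k a t).
Proof.
elim: m => [|m IHm] HP; first by exists [::], 0.
have HPm := IHm (fun k lt_km => HP k (ltnW lt_km)).
apply: forced_imply (forced_and (HP m (ltnSn m)) HPm) => a t [Pm lt_m] k.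
by rewrite ltnS leq_eqVlt => /predU1P[-> | /lt_m].
Qed.

Lemma sim_complete X c n m :
  eval X c n m -> forced X (fun a t => sim a t c n = m.+1).
Proof.
elim: c n m => [||||| c IHc d IHd | c IHc d IHd | c IHc d IHd | c IHc] n m /=;
  try by move=> ->; exists [::], 0.
- move=> Xnm; exists [:: n], 0 => a t _ /(_ n (mem_head _ _))->.
  by case: Xnm => -[Xn ->]; case: chiP.
- move=> [u [v [/IHc Hc /IHd Hd ->]]].
  by apply: forced_imply (forced_and Hc Hd) => a t [-> ->].
- move=> [u /IHd Hd /IHc Hc].
  by apply: forced_imply (forced_and Hc Hd) => a t [cE ->].
- rewrite -/(car n) -/(cdr n); elim: (cdr n) m => [|k IHk] m /=; first exact: IHc.
  move=> [r /IHk Hk /IHd Hd].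
  by apply: forced_imply (forced_and Hk Hd) => a t [-> ].
move=> [/IHc Hm lt_m].
have Hlt: forced X (fun a t => forall k, k < m -> exists v, sim a t c (cpair n k) = v.+2).
  apply: forced_forall => k /lt_m[v /IHc].
  by apply: forced_imply => a t ->; exists v.
have Ht: forced X (fun _ t => m < t) by exists [::], m.+1.
apply: forced_imply (forced_and Ht (forced_and Hm Hlt)) => a t [lt_mt [cm ck]].
set F := fun k r : nat => _.
have FE k : k <= m -> iteri k F 1 = 1.
  elim: k => // k IHk lt_km; rewrite /= IHk ?(ltnW lt_km) // /F /=.
  by have [v ->] := ck k lt_km.
rewrite -(subnK lt_mt); elim: (t - m.+1) => [|k]; rewrite ?add0n ?addSn /=.
  by rewrite FE // /F /= cm.
by case: (iteri _ _ _) => [|[|l]].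
Qed.

(** By recursion on the program [c], which is fixed: no universal program is
    needed. The resources may depend on the first component of the argument. *)
Lemma cf_sim I (O : I -> natset) (a : nat -> nat -> nat) (t : nat -> nat) c :
  computable_from O (fun _ z => a (car z) (cdr z)) -> computable_from O (fun _ => t) ->
  computable_from O (fun _ z => sim (a (car z)) (t (car z)) c (cdr z)).
Proof.
move=> Pa Pt.
have subst c' (f g : I -> nat -> nat) :
    computable_from O (fun _ z => sim (a (car z)) (t (car z)) c' (cdr z)) ->
    computable_from O f -> computable_from O g ->
    computable_from O (fun i z => sim (a (f i z)) (t (f i z)) c' (g i z)).
  move=> Pc Pf Pg; apply: eq_computable_from (cf_comp Pc (cf_pair Pf Pg)) => i z.
  by rewrite !cpairK.
have P1: computable_from O (fun _ z => car z) by exact: cf_car cf_id.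
have P2: computable_from O (fun _ z => cdr z) by exact: cf_cdr cf_id.
elim: c => [||||| c IHc d IHd | c IHc d IHd | c IHc d IHd | c IHc] /=.
- exact: cf_const.
- exact: cf_succ (cf_succ P2).
- exact: cf_succ (cf_car P2).
- exact: cf_succ (cf_cdr P2).
- exact: Pa.
- apply: cf_if (cf_and (cf_neq0 IHc) (cf_neq0 IHd)) _ (cf_const 0).
  exact: cf_succ (cf_pair (cf_pred IHc) (cf_pred IHd)).
- exact: cf_if (cf_neq0 IHd) (subst _ _ _ IHc P1 (cf_pred IHd)) (cf_const 0).
- apply: (cf_iteri (h := fun _ z k r => if r != 0 then
     sim (a (car z)) (t (car z)) d (cpair (car (cdr z)) (cpair k r.-1)) else 0))
     (subst _ _ _ IHc P1 (cf_car P2)) (cf_cdr P2) _.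
  apply: cf_if (cf_neq0 (cf_cdr P2)) _ (cf_const 0).
  apply: subst IHd (cf_car P1) _.
  exact: cf_pair (cf_car (cf_cdr P1)) (cf_pair (cf_car P2) (cf_pred (cf_cdr P2))).
apply: cf_pred.
apply: (cf_iteri (h := fun _ z k r => if r == 1 then
    if sim (a (car z)) (t (car z)) c (cpair (cdr z) k) == 1 then k.+2
    else sim (a (car z)) (t (car z)) c (cpair (cdr z) k) != 0 else r))
  (cf_const 1) (cf_comp Pt P1) _.
have Psim: computable_from O (fun _ z => sim (a (car (car z))) (t (car (car z))) c
    (cpair (cdr (car z)) (car (cdr z)))).
  exact: subst IHc (cf_car P1) (cf_pair (cf_cdr P1) (cf_car P2)).
apply: cf_if (cf_eq (cf_cdr P2) (cf_const 1)) _ (cf_cdr P2).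
apply: cf_if (cf_eq Psim (cf_const 1)) _ (cf_neq0 Psim).
exact: cf_succ (cf_succ (cf_car P2)).
Qed.

(** * Refutable families *)

(** Nonmembership is witnessed by membership: an element of [O i] that is
    incompatible with [n] in a computable way, the same for all [i]. *)
Definition refutable (I : Type) (O : I -> natset) : Prop :=
  exists2 r : nat -> nat -> bool, computable_fun (fun z => r (car z) (cdr z)) &
    forall i n, ~ O i n <-> exists2 y, O i y & r y n.

Lemma cf_rel I (O : I -> natset) (r : nat -> nat -> bool) (f g : I -> nat -> nat) :
  computable_fun (fun z => r (car z) (cdr z)) ->
  computable_from O f -> computable_from O g ->
  computable_from O (fun i n => r (f i n) (g i n)).
Proof.
move=> Pr Pf Pg; apply: eq_computable_from (cf_computable_fun Pr (cf_pair Pf Pg)) => i n.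
by rewrite !cpairK.
Qed.

Lemma computable_funP (f : nat -> nat) :
  (forall I (O : I -> natset), computable_from O (fun _ => f)) -> computable_fun f.
Proof.
by move=> /(_ unit (fun _ => no_oracle))[c /(_ tt) Hc]; exists c.
Qed.

(** The answer, in the format of [sim], that the sequence [s] of elements of a
    set gives about [n] by means of the refuter [r]: 2 for yes, 1 for no, 0 if
    [s] decides nothing. *)
Definition lookup (r : nat -> nat -> bool) (s : seq nat) (n : nat) : nat :=
  if has (fun x => x == n) s then 2 else has (fun x => r x n) s.

Section Refutable.
Variables (I : Type) (O Y : I -> natset).

(** The finite sets of the operator are those whose elements suffice, through
    [lookup], to run the given program. On subsets of [O i] all the answers of
    [lookup] are right, and finitely many elements answer the finitely many
    questions of a computation. *)
Lemma enumerable_of_computable :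
  refutable O -> computable_from O (fun i n => chi (Y i) n) ->
  exists2 W, ce W & forall i x, enum_apply W (O i) x <-> Y i x.
Proof.
move=> [r Pr rO] [c Hc].
pose p n t := sim (lookup r (decode (car n))) t c (cdr n) == 2.
exists (fun n => exists t, p n t).
  apply/ce_exists/computable_funP => J O'.
  apply: cf_eq (cf_const 2).
  pose a z := lookup r (decode (car (car z))).
  have Psim := @cf_sim J O' a cdr c _ (cf_cdr cf_id).
  apply: eq_computable_from (cf_comp (Psim _)
    (cf_pair (cf_pair (cf_car cf_id) (cf_cdr cf_id)) (cf_cdr (cf_car cf_id)))) => [j z|].
    by rewrite /a !cpairK.
  have Ps: computable_from O' (fun _ z => car (car (car z))) by exact: cf_car (cf_car (cf_car cf_id)).
  apply: cf_if; [| exact: cf_const | ].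
    apply: (cf_has (p := fun _ z x => x == cdr z)) Ps.
    exact: cf_eq (cf_cdr cf_id) (cf_cdr (cf_car cf_id)).
  apply: (cf_has (p := fun _ z x => r x (cdr z))) Ps.
  exact: cf_rel Pr (cf_cdr cf_id) (cf_cdr (cf_car cf_id)).
have sound i s : (forall y, y \in s -> O i y) ->
    forall y v, lookup r s y = v.+1 -> v = chi (O i) y.
  move=> sO y v; rewrite /lookup; case: hasP => [[x sx /eqP<-] [<-] | _].
    by case: chiP => // -[]; apply: sO.
  case: hasP => //= -[x sx rxy] [<-]; case: chiP => //.
  by move=> Oy; case: ((rO i y).2 _ Oy); exists x => //; apply: sO.
move=> i x; split=> [[s [sO [t]]] | Yx].
  rewrite /p !cpairK cseqK => /eqP/(sim_sound (sound i s sO)) cx.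
  by have := eval_det (Hc i x) cx; case: chiP.
have := Hc i x; have [_ |//] := chiP (Y i) x; move=> /sim_complete[q [t0 Hq]].
(* A nonelement [y] of [O i] among the queries is settled by a refutation. *)
have [s sO qs] : exists2 s, (forall y, y \in s -> O i y) &
    {in q, forall y, lookup r s y = (chi (O i) y).+1}.
  have {Hq} [s sO qs] : exists2 s, (forall y, y \in s -> O i y) &
      {in q, forall y, lookup r s y <> 0}.
    elim: q {Hq} => [|y q [s sO qs]]; first by exists [::].
    have [z Oz zy] : exists2 z, O i z & (z == y) || r z y.
      have [Oy | /rO[z Oz rzy]] := chiP (O i) y; first by exists y; rewrite ?eqxx.
      by exists z; rewrite ?rzy ?orbT.
    exists (z :: s) => [w | w].
      by rewrite inE => /predU1P[-> | /sO].
    rewrite inE /lookup /= => /predU1P[-> | /qs].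
      by case: eqP zy => //= _ ->; case: has.
    by rewrite /lookup; case: has; rewrite ?orbT //; case: eqP => //=; case: has; rewrite ?orbT.
  exists s => // y /qs; case lE: lookup => [|v] // _.
  by rewrite (sound i s sO y v).
exists s; split=> //; exists t0.
by rewrite /p !cpairK cseqK (Hq _ t0).
Qed.

(** Enumerate [Y i] until [n] or a refutation of [n] shows up, which must
    happen since [n] is either inside or outside [Y i]. *)
Lemma computable_of_enumerable W :
  refutable Y -> ce W -> (forall i x, enum_apply W (O i) x <-> Y i x) ->
  computable_from O (fun i n => chi (Y i) n).
Proof.
move=> [r Pr rY] [c Wc] WY.
(* [W] is presented as the projection of a computable relation, to dovetail
   the enumeration of [W] with the search for an input. *)
pose w n t := sim (fun _ => 1) t c n != 0.
have WE n : W n <-> exists t, w n t.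
  rewrite Wc; split=> [[m /sim_complete[q [t0 Hq]]] | [t]].
    exists t0; rewrite /w (Hq _ t0) // => y _.
    by case: chiP.
  rewrite /w; case cE: sim => [|m] // _; exists m; apply: sim_sound cE => y _ [<-].
  by case: chiP.
(* [z] packs an element [y], the code [s] of a finite set witnessing that it is
   enumerated, and the length [t] of the computation. *)
pose p i n z := [&& all (chi (O i)) (decode (car (cdr z))),
  w (cpair (car (cdr z)) (car z)) (cdr (cdr z)) & (car z == n) || r (car z) n].
have pY i n z : p i n z -> Y i (car z).
  case/and3P=> /allP sO wz _; apply/WY; exists (decode (car (cdr z))).
  split=> [y /sO /chiP // |]; rewrite decodeK; apply/WE; by eexists; apply: wz.
have Yp i n y : Y i y -> (y == n) || r y n -> exists z, p i n z.
  move=> /WY[s [sO /WE[t wt]]] yn; exists (cpair y (cpair (cseq s) t)).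
  rewrite /p !cpairK cseqK wt yn !andbT; by apply/allP=> x /sO /chiP.
have [|i n|f Pf pf] := @cf_search _ O p.
- have P1: computable_from O (fun _ z => car z) by exact: cf_car cf_id.
  have P2: computable_from O (fun _ z => cdr z) by exact: cf_cdr cf_id.
  apply: cf_and.
    apply: (cf_all (p := fun i _ => chi (O i))) (cf_car (cf_cdr P2)).
    exact: cf_comp cf_oracle P2.
  apply: cf_and; last exact: cf_or (cf_eq (cf_car P2) P1) (cf_rel Pr (cf_car P2) P1).
  apply: cf_neq0.
  have Psim := @cf_sim I O (fun _ _ => 1) id c (cf_const 1) cf_id.
  apply: eq_computable_from (cf_comp Psim (cf_pair (cf_cdr (cf_cdr P2))
    (cf_pair (cf_car (cf_cdr P2)) (cf_car P2)))) => i z.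
  by rewrite !cpairK.
- have [Yn | /rY[y Yy ryn]] := chiP (Y i) n.
    by apply: Yp Yn _; rewrite eqxx.
  by apply: Yp Yy _; rewrite ryn orbT.
apply: eq_computable_from (cf_eq (cf_car Pf) cf_id) => i n.
have Yf := pY _ _ _ (pf i n); have [fn | fn] := eqP.
  by rewrite -fn; case: chiP.
case: chiP => // Yn; case/and3P: (pf i n) => _ _ /predU1P[//|rfn].
by case: ((rY i n).2 _ Yn); exists (car (f i n)).
Qed.

End Refutable.

(** * Joins, graphs and diagrams are refutable *)

Lemma chi_iff X Y n m : (X n <-> Y m) -> chi X n = chi Y m.
Proof. by move=> XY; apply/chiP/chiP => /XY. Qed.

Lemma joinE X Y n : join X Y n <-> if odd n then Y n./2 else X n./2.
Proof.
split=> [[[x Xx ->] | [y Yy ->]] |].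
- by rewrite odd_double doubleK.
- by rewrite /= odd_double uphalf_double.
case: ifP => oddn; [right | left]; exists n./2 => //;
  by rewrite -[LHS]odd_double_half oddn.
Qed.

Lemma graphE f n : graph f n <-> f (car n) = cdr n.
Proof.
split=> [[x [y [fx ->]]] | fn]; first by rewrite !cpairK.
by exists (car n), (cdr n); rewrite cpairE.
Qed.

Lemma refutable_join I (X Y : I -> natset) :
  refutable X -> refutable Y -> refutable (fun i => join (X i) (Y i)).
Proof.
move=> [rX PX HX] [rY PY HY].
exists (fun y n => (odd y == odd n) && (if odd n then rY y./2 n./2 else rX y./2 n./2)).
  apply: computable_funP => J O.
  have P1 := @cf_car J O _ cf_id; have P2 := @cf_cdr J O _ cf_id.
  apply: cf_and.
    apply: eq_computable_from (cf_eq (cf_odd P1) (cf_odd P2)) => j z.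
    by do 2!case: odd.
  have := cf_if (cf_odd P2) (cf_rel PY (cf_half P1) (cf_half P2))
    (cf_rel PX (cf_half P1) (cf_half P2)).
  by apply: eq_computable_from => j z; case: ifP.
move=> i n; rewrite joinE; case oddn: (odd n).
  rewrite HY; split=> [[y Yy ryn] | [y /joinE Yy /andP[/eqP odd_y ryn]]]; last first.
    by exists y./2 => //; rewrite odd_y in Yy.
  exists y.*2.+1; first by apply/joinE; rewrite /= odd_double uphalf_double.
  by rewrite /= odd_double uphalf_double.
rewrite HX; split=> [[y Yy ryn] | [y /joinE Yy /andP[/eqP odd_y ryn]]]; last first.
  by exists y./2 => //; rewrite odd_y in Yy.
by exists y.*2; [apply/joinE|]; rewrite odd_double doubleK.
Qed.

(** The value taken by a function at [x] excludes all other values at [x]. *)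
Lemma refutable_graph I (f : I -> nat -> nat) : refutable (fun i => graph (f i)).
Proof.
exists (fun y n => (car y == car n) && (cdr y != cdr n)).
  apply: computable_funP => J O.
  have P1 := @cf_car J O _ cf_id; have P2 := @cf_cdr J O _ cf_id.
  exact: cf_and (cf_eq (cf_car P1) (cf_car P2)) (cf_neg (cf_eq (cf_cdr P1) (cf_cdr P2))).
move=> i n; rewrite graphE; split=> [fn | [y /graphE fy /andP[/eqP<- /eqP nyn]]].
  exists (cpair (car n) (f i (car n))); first by apply/graphE; rewrite !cpairK.
  by rewrite !cpairK eqxx; apply/eqP.
by rewrite fy.
Qed.

(** To compute a function from its graph, search for the value. *)
Lemma computable_from_graph I (O : I -> natset) f :
  computable_from O f <-> computable_from O (fun i n => chi (graph (f i)) n).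
Proof.
split=> [Pf | Pgraph].
  apply: eq_computable_from (cf_eq (cf_comp Pf (cf_car cf_id)) (cf_cdr cf_id)) => i n.
  by congr nat_of_bool; apply/eqP/chiP => /graphE.
have [|i n|g Pg gP] := @cf_search _ O (fun i x y => chi (graph (f i)) (cpair x y)).
- apply: eq_computable_from Pgraph => i z; by rewrite cpairE.
- by exists (f i n); apply/chiP/graphE; rewrite !cpairK.
apply: eq_computable_from Pg => i n.
by have /chiP/graphE := gP i n; rewrite !cpairK.
Qed.

Section Diagrams.
Variable L : language.
Implicit Types C D : structure L.

(** The sequence [s] is not typed as a tuple, so that the index [j] of the
    relation, on which the arity depends, can be rewritten. *)
Definition literal C (j : nat) (b : bool) (s : seq nat) : Prop :=
  exists2 t : (arity L j).-tuple nat, s = t & if b then ~ C j t else C j t.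

Lemma literal_size C j b s : literal C j b s -> size s = arity L j.
Proof. by case=> t -> _; rewrite size_tuple. Qed.

Lemma literalN C j b s :
  size s = arity L j -> ~ literal C j b s <-> literal C j (~~ b) s.
Proof.
move=> /eqP sz; split=> [nCs | [t st Ct] [t' st' Ct']].
  exists (Tuple sz) => //; have [Ct | nCt] := classic (C j (Tuple sz)).
    by case: b nCs => //= -[]; exists (Tuple sz).
  by case: b nCs => //= -[]; exists (Tuple sz).
have tt' : t = t' by apply: val_inj; rewrite /= -st.
by rewrite tt' in Ct; case: b Ct Ct'.
Qed.

(** An even element of a diagram is a relation that holds, an odd one is the
    negation of a relation; halving removes this bit. *)
Lemma diagramE C n :
  diagram C n <-> literal C (car n./2) (odd n) (decode (cdr n./2)).
Proof.
have bigjoinE (R : structure L) m : bigjoin (fun j => tuple_codes (R j)) m <->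
    exists2 t : (arity L (car m)).-tuple nat, decode (cdr m) = t & R (car m) t.
  split=> [[j [_ [[t Rt ->] def_m]]] | [t mt Rt]]; last first.
    exists (car m), (cdr m); split; last by rewrite cpairE.
    by exists t; rewrite // -mt decodeK.
  have mj : car m = j by rewrite def_m car_cpair.
  have ->: cdr m = cseq t by rewrite def_m cdr_cpair.
  by clear def_m; subst j; exists t; rewrite ?cseqK.
rewrite /diagram joinE /literal; case: ifP => _; first exact: (bigjoinE (fun j t => ~ C j t)).
exact: bigjoinE.
Qed.

(** The same atomic formula with the opposite sign. *)
Definition dual (n : nat) : nat := if odd n then n.-1 else n.+1.

Lemma odd_dual n : odd (dual n) = ~~ odd n.
Proof. by rewrite /dual; case: ifP => //= on; rewrite ?on //; case: n on => //= n /negbTE->. Qed.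

Lemma half_dual n : (dual n)./2 = n./2.
Proof.
rewrite /dual; case: ifP => [|on]; last by rewrite /= uphalf_half on.
by case: n => //= n /negbTE on; rewrite uphalf_half on.
Qed.

(** For the tuple of zeros, relation 0 or its negation holds. *)
Lemma diagram_inhabited C : exists n, diagram C n.
Proof.
pose t := [tuple of nseq (arity L 0) 0].
have [Ct | nCt] := classic (C 0 t).
  by exists (cpair 0 (cseq t)).*2; left; eexists; [exists 0, (cseq t); split=> //; exists t|].
by exists (cpair 0 (cseq t)).*2.+1; right; eexists; [exists 0, (cseq t); split=> //; exists t|].
Qed.

(** A literal is refuted by its dual. A number that encodes a relation with a
    wrong number of arguments belongs to no diagram, and the computability of
    the arities lets any element refute it. *)
Lemma refutable_diagram I (C : I -> structure L) : refutable (fun i => diagram (C i)).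
Proof.
exists (fun y n => (size (decode (cdr n./2)) != arity L (car n./2)) || (y == dual n)).
  apply: computable_funP => J O.
  have P1 := @cf_car J O _ cf_id; have P2 := @cf_cdr J O _ cf_id.
  apply: cf_or.
    apply: cf_neg (cf_eq (cf_size (cf_cdr (cf_half P2))) _).
    exact: cf_computable_fun (arity_computable L) (cf_car (cf_half P2)).
  exact: cf_eq P1 (cf_if (cf_odd P2) (cf_pred P2) (cf_succ P2)).
move=> i n; have [sz | sz] /= := eqVneq (size (decode (cdr n./2))).
  rewrite diagramE literalN // -odd_dual -[n./2]half_dual -diagramE.
  by split=> [Cn | [y Cy /eqP<-] //]; exists (dual n).
split=> [_ | _ /diagramE/literal_size/eqP]; last by rewrite (negbTE sz).
by have [y Cy] := diagram_inhabited (C i); exists y.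
Qed.

(** The action of [f] on the arguments of a literal. *)
Definition relabel (f : nat -> nat) (n : nat) : nat :=
  odd n + (cpair (car n./2) (cseq (map f (decode (cdr n./2))))).*2.

Lemma odd_relabel f n : odd (relabel f n) = odd n.
Proof. by rewrite /relabel oddD odd_double addbF oddb. Qed.

Lemma half_relabel f n :
  (relabel f n)./2 = cpair (car n./2) (cseq (map f (decode (cdr n./2)))).
Proof. by rewrite /relabel half_bit_double. Qed.

Lemma relabelK f g : cancel g f -> cancel (relabel g) (relabel f).
Proof.
move=> gK n; rewrite {1}/relabel odd_relabel half_relabel !cpairK cseqK.
by rewrite mapK // decodeK cpairE odd_double_half.
Qed.

Lemma diagram_relabel C D (f : iso C D) n : diagram C n <-> diagram D (relabel f n).
Proof.
have [_ isoP] := iso_funP f.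
rewrite !diagramE odd_relabel half_relabel !cpairK cseqK.
split=> [[t -> Ct] | [t st Dt]].
  by exists (map_tuple f t) => //; case: ifP Ct => _; rewrite isoP.
have sz: size (decode (cdr n./2)) == arity L (car n./2).
  by rewrite -(size_map f) st size_tuple.
have def_t : t = map_tuple f (Tuple sz) by apply: val_inj; rewrite /= -st.
by exists (Tuple sz) => //; case: ifP Dt => _; rewrite def_t isoP.
Qed.

End Diagrams.

Lemma cf_relabel I (O : I -> natset) f k :
  computable_from O f -> computable_from O k ->
  computable_from O (fun i n => relabel (f i) (k i n)).
Proof.
move=> Pf Pk; apply: cf_add (cf_odd Pk) (cf_double _).
exact: cf_pair (cf_car (cf_half Pk)) (cf_map Pf (cf_cdr (cf_half Pk))).
Qed.

(** * Functors *)

Section Functors.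
Variables (L1 L2 : language) (K1 : struct_class L1) (K2 : struct_class L2).
Implicit Types F G : functor K1 K2.

Definition obj_oracle (C : obj K1) : natset := diagram C.

(** Morphisms are bundled with their source and target, to index a family of
    oracles. *)
Definition morphism := {CD : obj K1 * obj K1 & iso CD.1 CD.2}.
Definition source (h : morphism) : obj K1 := (projT1 h).1.
Definition target (h : morphism) : obj K1 := (projT1 h).2.
Definition arrow (h : morphism) : iso (source h) (target h) := projT2 h.
Definition mor_oracle (h : morphism) : natset := hom_oracle (arrow h).

Lemma computable_functorE F : computable_functor F <->
  computable_from obj_oracle (fun C n => chi (diagram (F C)) n) /\
  computable_from mor_oracle (fun h => fmap F (arrow h)).
Proof.
split=> [[Phi [Phi' PhiF]] | [[Phi HPhi] [Phi' HPhi']]].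
  split; [exists Phi => C | exists Phi' => -[[C D] f]].
    exact/computes_setE/(PhiF C C).1.
  exact: (PhiF C D).2.
exists Phi, Phi' => C D; split; first by apply/computes_setE/HPhi.
by move=> f; apply: (HPhi' (existT _ (C, D) f)).
Qed.

Lemma enumerable_functorE F : enumerable_functor F <->
  (exists2 W, ce W &
    forall C x, enum_apply W (obj_oracle C) x <-> diagram (F C) x) /\
  (exists2 W, ce W &
    forall h x, enum_apply W (mor_oracle h) x <-> graph (fmap F (arrow h)) x).
Proof.
split=> [[W [W' [ceW ceW' WF]]] | [[W ceW HW] [W' ceW' HW']]].
  split; [exists W => // C x | exists W' => // -[[C D] f] x].
    exact: (WF C C).1.
  exact: (WF C D).2.
exists W, W'; split=> // C D; split; first exact: HW.
by move=> f; apply: (HW' (existT _ (C, D) f)).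
Qed.

(** The oracles and the outputs are diagrams, graphs and joins of these, all of
    which are refutable. *)
Lemma computable_iff_enumerable F : computable_functor F <-> enumerable_functor F.
Proof.
have refO : refutable obj_oracle by exact: refutable_diagram.
have refM : refutable mor_oracle.
  apply: refutable_join; last exact: refutable_diagram.
  by apply: refutable_join; [apply: refutable_diagram | apply: refutable_graph].
rewrite computable_functorE enumerable_functorE
  (computable_from_graph mor_oracle).
split=> [[PO PM] | [[W ceW HW] [W' ceW' HW']]].
  by split; [apply: enumerable_of_computable refO PO
            | apply: enumerable_of_computable refM PM].
split; [apply: computable_of_enumerable ceW HW | apply: computable_of_enumerable ceW' HW'].
  exact: refutable_diagram.
exact: refutable_graph.
Qed.

(** The diagram of the source is the part of the oracle of a morphism that
    consists of the multiples of 4, and that of the target is its odd part. *)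
Lemma cf_source (g : obj K1 -> nat -> nat) :
  computable_from obj_oracle g -> computable_from mor_oracle (fun h => g (source h)).
Proof.
apply: computable_from_reindex.
apply: eq_computable_from (cf_comp cf_oracle (cf_double (cf_double cf_id))) => h n.
congr nat_of_bool; apply: chi_iff.
by rewrite /mor_oracle /hom_oracle !(joinE, odd_double, doubleK).
Qed.

Lemma cf_target (g : obj K1 -> nat -> nat) :
  computable_from obj_oracle g -> computable_from mor_oracle (fun h => g (target h)).
Proof.
apply: computable_from_reindex.
apply: eq_computable_from (cf_comp cf_oracle (cf_succ (cf_double cf_id))) => h n.
congr nat_of_bool; apply: chi_iff.
by rewrite /mor_oracle /hom_oracle joinE /= odd_double uphalf_double.
Qed.

(** The inverse [inv] of [lam] is found by search. Then the diagram of [F C] is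
    that of [G C] relabelled, and naturality reads
    [F h = lam o G h o inv]. *)
Lemma computable_functor_transfer F G :
  effectively_isomorphic_to G F -> computable_functor G -> computable_functor F.
Proof.
move=> [c [lam [Plam nat_lam]]] /computable_functorE[PO PM].
have {c}Plam : computable_from obj_oracle (fun C => lam C) by exists c => C; apply: Plam.
have [||inv Pinv invP] := @cf_search _ obj_oracle (fun C n m => lam C m == n).
- exact: cf_eq (cf_comp Plam (cf_cdr cf_id)) (cf_car cf_id).
- move=> C n; have [[g _ gK] _] := iso_funP (lam C).
  by exists (g n); rewrite gK.
have invK C : cancel (inv C) (lam C) by move=> n; apply/eqP/invP.
apply/computable_functorE; split.
  apply: eq_computable_from (cf_comp PO (cf_relabel Pinv cf_id)) => C n.
  congr nat_of_bool; apply: chi_iff.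
  by rewrite (diagram_relabel (lam C)) relabelK.
apply: eq_computable_from (cf_comp (cf_target Plam) (cf_comp PM (cf_source Pinv))) => h n.
by have /= -> := nat_lam _ _ (arrow h) (inv (source h) n); rewrite invK.
Qed.

Lemma effectively_isomorphic_refl F : effectively_isomorphic_to F F.
Proof.
have [c Hc] : computable_from obj_oracle (fun C => iso_id (F C)) by exact: cf_id.
by exists c, (fun C => iso_id (F C)).
Qed.

End Functors.

Theorem theorem8 (L1 L2 : language) (A : structure L1) (B : structure L2)
    (F : functor (iso_class A) (iso_class B)) :
  computable_functor F <->
  exists G : functor (iso_class A) (iso_class B),
    enumerable_functor G /\ effectively_isomorphic_to G F.
Proof.
split=> [/computable_iff_enumerable enumF | [G [enumG isoGF]]].
  by exists F; split; last exact: effectively_isomorphic_refl.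
exact: computable_functor_transfer isoGF (proj2 (computable_iff_enumerable G) enumG).
Qed.
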